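(* Let $\mathfrak{g}$ be an arbitrary finite-dimensional complex Lie algebra and $\overline{\mathfrak{g}}=\mathfrak{g}\otimes\mathbb{C}[z^{-1},z]$, with $A_n:=z^n$. The two-cocycles of $\overline{\mathfrak{g}}$ with values in the adjoint module given by $$\omega(x\otimes A_n,y\otimes A_m)=\begin{cases}0,& n\text{ or }m\text{ even},\\ [x,y]\otimes A_{n+m-2},& n\text{ and }m\text{ both odd},\end{cases}$$ and by $$\omega(x\otimes A_n,y\otimes A_m)=\begin{cases}0,& n\text{ or }m\text{ even},\\ [x,y]\otimes A_{n+m-4},& n\text{ and }m\text{ both odd},\end{cases}$$ are cohomologically trivial. Hence, considered as infinitesimal deformations of $\overline{\mathfrak{g}}$, the families $\overline{\mathcal{G}}^s_{(e)}$, $s\in\mathbb{C}\cup\{\infty\}$, are trivial.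
   Context: The bracket of $\overline{\mathfrak{g}}$ is $[x\otimes z^n,y\otimes z^m]=[x,y]\otimes z^{n+m}$. A Lie algebra two-cocycle of $\mathcal{L}$ with values in the adjoint module is an alternating bilinear map $\omega:\mathcal{L}\times\mathcal{L}\to\mathcal{L}$ with $\omega([x,y],z)-\omega([x,z],y)+\omega([y,z],x)-[x,\omega(y,z)]+[y,\omega(x,z)]-[z,\omega(x,y)]=0$. It is cohomologically trivial (a coboundary) if there is a linear map $\eta:\mathcal{L}\to\mathcal{L}$ with $\omega(x,y)=\eta([x,y])-[x,\eta(y)]-[\eta(x),y]$. $\overline{\mathcal{G}}^s_{(e)}$ is the family of Lie algebras over $\mathbb{C}[e]$ on $\mathfrak{g}\otimes V$, $V$ with basis $\{A_n\mid n\in\mathbb{Z}\}$, with bracket $[x\otimes A_n,y\otimes A_m]=[x,y]\otimes A_{n+m}$ if $n$ or $m$ is even and, if $n,m$ are both odd, $[x,y]\otimes\big(A_{n+m}+3eA_{n+m-2}+e^2(1-s)(2+s)A_{n+m-4}\big)$ for $s\neq\infty$, respectively $[x,y]\otimes\big(A_{n+m}-eA_{n+m-4}\big)$ for $s=\infty$. The first cocycle is (up to a nonzero scalar) the coefficient of $e$ for $s\neq\infty$, the second for $s=\infty$. A family over $\mathbb{C}[e]$ considered as an infinitesimal deformation is its reduction to the base $\mathbb{C}[e]/(e^2)$: a Lie $\mathbb{C}[e]/(e^2)$-algebra structure on $\mathbb{C}[e]/(e^2)\otimes\overline{\mathfrak{g}}$ reducing to $\overline{\mathfrak{g}}$ at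 $e=0$. It is trivial if it is equivalent (isomorphic over $\mathbb{C}[e]/(e^2)$, compatibly with reduction at $e=0$) to the one with trivially extended bracket. *)

(* Defs.v *)
From HB Require Import structures.
From mathcomp Require Import all_boot all_order all_algebra.
From mathcomp Require Import finmap complex reals.

Set Implicit Arguments.
Unset Strict Implicit.
Unset Printing Implicit Defensive.

Import GRing.Theory.
Local Open Scope ring_scope.

Section LieAlgebra.
Variables (K : comNzRingType) (L : lmodType K).
Implicit Types (br omega : L -> L -> L).

Definition alternating_bilinear br : Prop :=
  bilinear_for *:%R *:%R br /\ forall x, br x x = 0.

Definition lie_bracket br : Prop :=
  alternating_bilinear br /\
  forall x y z, br x (br y z) + br y (br z x) + br z (br x y) = 0.

Definition two_cocycle br omega : Prop :=
  alternating_bilinear omega /\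
  forall x y z,
    omega (br x y) z - omega (br x z) y + omega (br y z) x
    - br x (omega y z) + br y (omega x z) - br z (omega x y) = 0.

Definition coboundary br omega : Prop :=
  exists eta : {linear L -> L},
    forall x y, omega x y = eta (br x y) - br x (eta y) - br (eta x) y.

End LieAlgebra.

(* [laurent M] is M (x) V for V free on the basis (A_n), n in int: the sum    *)
(* of the x_n (x) A_n is encoded as the finitely supported n |-> x_n.  When V *)
(* is the space of Laurent polynomials, A_n is z^n.                           *)

Definition laurent (M : zmodType) : Type := {fsfun int -> M with 0}.

Section LaurentZmodule.
Variable M : zmodType.
Implicit Types u v w : laurent M.

HB.instance Definition _ :=
  Choice.copy (laurent M) {fsfun int -> M with 0}.

Definition laurent_zero : laurent M := [fsfun].
Definition laurent_opp u : laurent M := [fsfun n in finsupp u => - u n].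
Definition laurent_add u v : laurent M :=
  [fsfun n in (finsupp u `|` finsupp v)%fset => u n + v n].

Lemma laurent_oppE u n : laurent_opp u n = - u n.
Proof. by rewrite fsfunE; case: finsuppP => //; rewrite oppr0. Qed.

Lemma laurent_addE u v n : laurent_add u v n = u n + v n.
Proof.
rewrite fsfunE in_fsetU.
by case: finsuppP => _; case: finsuppP => _ //=; rewrite addr0.
Qed.

Lemma laurent_addA : associative laurent_add.
Proof. by move=> u v w; apply/fsfunP => n; rewrite !laurent_addE addrA. Qed.

Lemma laurent_addC : commutative laurent_add.
Proof. by move=> u v; apply/fsfunP => n; rewrite !laurent_addE addrC. Qed.

Lemma laurent_add0 : left_id laurent_zero laurent_add.
Proof.
by move=> u; apply/fsfunP => n; rewrite laurent_addE fsfunE add0r.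
Qed.

Lemma laurent_addN : left_inverse laurent_zero laurent_opp laurent_add.
Proof.
move=> u; apply/fsfunP => n.
by rewrite laurent_addE laurent_oppE addNr fsfunE.
Qed.

HB.instance Definition _ := GRing.isZmodule.Build (laurent M)
  laurent_addA laurent_addC laurent_add0 laurent_addN.

Lemma laurentD u v n : (u + v) n = u n + v n.
Proof. exact: laurent_addE. Qed.

Lemma laurent0 n : (0 : laurent M) n = 0.
Proof. exact: fsfun0E. Qed.

Definition tensA (x : M) (n : int) : laurent M := [fsfun k in [fset n]%fset => x].

Lemma tensAE x n k : tensA x n k = if k == n then x else 0.
Proof. by rewrite fsfunE in_fset1. Qed.

End LaurentZmodule.

Notation "x '*A' n" := (tensA x n) (at level 40) : ring_scope.

Section LaurentLmodule.
Variables (K : nzRingType) (M : lmodType K).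

Definition laurent_scale (a : K) (u : laurent M) : laurent M :=
  [fsfun n in finsupp u => a *: u n].

Lemma laurent_scaleE a u n : laurent_scale a u n = a *: u n.
Proof. by rewrite fsfunE; case: finsuppP => //; rewrite scaler0. Qed.

Lemma laurent_scaleA a b u :
  laurent_scale a (laurent_scale b u) = laurent_scale (a * b) u.
Proof. by apply/fsfunP => n; rewrite !laurent_scaleE scalerA. Qed.

Lemma laurent_scale1 : left_id 1 laurent_scale.
Proof. by move=> u; apply/fsfunP => n; rewrite laurent_scaleE scale1r. Qed.

Lemma laurent_scaleDr : right_distributive laurent_scale +%R.
Proof.
move=> a u v; apply/fsfunP => n.
by rewrite !(laurent_scaleE, laurentD) scalerDr.
Qed.

Lemma laurent_scaleDl u : {morph laurent_scale^~ u : a b / a + b}.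
Proof.
move=> a b; apply/fsfunP => n.
by rewrite !(laurent_scaleE, laurentD) scalerDl.
Qed.

HB.instance Definition _ := GRing.Zmodule_isLmodule.Build K (laurent M)
  laurent_scaleA laurent_scale1 laurent_scaleDr laurent_scaleDl.

Lemma laurentZ a (u : laurent M) n : (a *: u) n = a *: u n.
Proof. exact: laurent_scaleE. Qed.

End LaurentLmodule.

(* The map f (x) id, for f additive. *)
Definition laurent_map (M N : zmodType) (f : M -> N) (u : laurent M) :
    laurent N :=
  [fsfun n in finsupp u => f (u n)].

(* The bilinear map given on generators by                                    *)
(* (x (x) A_n, y (x) A_m) |-> f n m x y.                                      *)
Definition bilin_ext (M N : zmodType) (f : int -> int -> M -> M -> laurent N)
    (u v : laurent M) : laurent N :=
  \sum_(n <- finsupp u) \sum_(m <- finsupp v) f n m (u n) (v m).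

Lemma bilin_ext_tensA (M N : zmodType)
    (f : int -> int -> M -> M -> laurent N) (n m : int) (x y : M) :
  (forall i j z, f i j 0 z = 0) -> (forall i j z, f i j z 0 = 0) ->
  bilin_ext f (x *A n) (y *A m) = f n m x y.
Proof.
move=> f0l f0r; rewrite /bilin_ext.
have supp k (z : M) : z != 0 -> finsupp (z *A k) = [fset k]%fset.
  move=> z0; apply/fsetP => i; rewrite mem_finsupp tensAE in_fset1.
  by case: (i == k); rewrite ?eqxx.
have supp0 k : finsupp ((0 : M) *A k) = fset0.
  by apply/fsetP => i; rewrite mem_finsupp tensAE if_same eqxx.
have [->|x0] := eqVneq x 0; first by rewrite supp0 big_seq_fset0 f0l.
rewrite supp // big_seq_fset1 tensAE eqxx.
have [->|y0] := eqVneq y 0; first by rewrite supp0 big_seq_fset0 f0r.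
by rewrite supp // big_seq_fset1 tensAE eqxx.
Qed.

Definition oddz (n : int) : bool := odd `|n|%N.

Section CurrentAlgebra.
Variables (K : comNzRingType) (M : lmodType K) (br : M -> M -> M).

Definition current_bracket : laurent M -> laurent M -> laurent M :=
  bilin_ext (fun n m x y => br x y *A (n + m)).

Definition omega (d : int) : laurent M -> laurent M -> laurent M :=
  bilin_ext (fun n m x y =>
    if oddz n && oddz m then br x y *A (n + m - d) else 0).

End CurrentAlgebra.

(* Extension of scalars of a finite-dimensional F-space g to a commutative    *)
(* F-algebra K: K (x) g is the free K-module on the basis [vbasis {:g}] of g. *)

Section ScalarExtension.
Variables (F : fieldType) (K : comAlgType F) (g : vectType F).

Definition scalar_ext : Type := 'rV[K]_(\dim {:g}).
HB.instance Definition _ := GRing.Lmodule.on scalar_ext.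

Definition ext_tens (a : K) (x : g) : scalar_ext :=
  \row_i (coord (vbasis {:g}) i x *: a).

Definition ext_bracket (br : g -> g -> g) (u v : scalar_ext) : scalar_ext :=
  \sum_i \sum_j
    ext_tens (u 0 i * v 0 j) (br (vbasis {:g})`_i (vbasis {:g})`_j).

Lemma ext_bracket_tens (br : g -> g -> g) (a b : K) (x y : g) :
  bilinear_for *:%R *:%R br ->
  ext_bracket br (ext_tens a x) (ext_tens b y) = ext_tens (a * b) (br x y).
Proof.
move=> [brl brr]; pose B := vbasis {:g}.
have br0l z : br 0 z = 0.
  by have := brl z (-1) 0 0; rewrite /= scaler0 addr0 scaleN1r addNr.
have br0r z : br z 0 = 0.
  by have := brr z (-1) 0 0; rewrite /= scaler0 addr0 scaleN1r addNr.
have brDl z : {morph br^~ z : u v / u + v}.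
  by move=> u v; have := brl z 1 u v; rewrite /= !scale1r.
have brDr z : {morph br z : u v / u + v}.
  by move=> u v; have := brr z 1 u v; rewrite /= !scale1r.
have brZl z c u : br (c *: u) z = c *: br u z.
  by have := brl z c u 0; rewrite /= addr0 br0l addr0.
have brZr z c u : br z (c *: u) = c *: br z u.
  by have := brr z c u 0; rewrite /= addr0 br0r addr0.
have brE : br x y = \sum_i \sum_j
    (coord B i x * coord B j y) *: br B`_i B`_j.
  rewrite {1}(coord_vbasis (memvf x)) (big_morph _ (brDl y) (br0l y)).
  apply: eq_bigr => i _; rewrite brZl {1}(coord_vbasis (memvf y)).
  rewrite (big_morph _ (brDr _) (br0r _)) scaler_sumr.
  by apply: eq_bigr => j _; rewrite brZr scalerA.
apply/rowP => k; rewrite brE !mxE linear_sum scaler_suml summxE.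
apply: eq_bigr => i _; rewrite linear_sum scaler_suml summxE.
apply: eq_bigr => j _; rewrite !mxE linearZ /=.
by rewrite -scalerAl -scalerAr !scalerA -mulrA mulrC.
Qed.

End ScalarExtension.

(* A map of scalars f : K -> K' induces f (x) id : K (x) g -> K' (x) g.       *)
Definition ext_map (F : fieldType) (K K' : comAlgType F) (g : vectType F)
    (f : K -> K') (u : scalar_ext K g) : scalar_ext K' g :=
  map_mx f u.

Section Deformations.
Variables (F : fieldType) (g : vectType F) (br : g -> g -> g).

(* F[e] is {poly F} with e = 'X, and F[e]/(e^2) is {poly %/ 'X^2}. *)
Notation dual := {poly %/ ('X^2 : {poly F})}.

(* F[e] (x) g (x) V and F[e]/(e^2) (x) g (x) V. *)
Notation laurent_poly := (laurent (scalar_ext {poly F} g)).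
Notation laurent_dual := (laurent (scalar_ext dual g)).

(* s = None stands for s = infinity. *)
Definition familyG (s : option F) :
    laurent_poly -> laurent_poly -> laurent_poly :=
  bilin_ext (fun n m x y =>
    let z := ext_bracket br x y in
    if oddz n && oddz m then
      if s is Some s then
        z *A (n + m) + ((3%:R * 'X) *: z) *A (n + m - 2)
        + (('X^2 * ((1 - s) * (2%:R + s))%:P) *: z) *A (n + m - 4)
      else z *A (n + m) - ('X *: z) *A (n + m - 4)
    else z *A (n + m)).

Definition mod_e2 : laurent_poly -> laurent_dual :=
  laurent_map (ext_map (in_qpoly 'X^2 : {poly F} -> dual)).

(* e |-> 0, followed by the identification of F (x) g with g. *)
Definition at_e0 : laurent_dual -> laurent g :=
  laurent_map (fun x : scalar_ext dual g =>
    \sum_i (x 0 i : {poly F})`_0 *: (vbasis {:g})`_i).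

(* mu is determined by G, since mod_e2 is surjective. *)
Definition reduction_mod_e2 (G : laurent_poly -> laurent_poly -> laurent_poly)
    (mu : laurent_dual -> laurent_dual -> laurent_dual) : Prop :=
  forall u v, mod_e2 (G u v) = mu (mod_e2 u) (mod_e2 v).

Definition infinitesimal_deformation
    (mu : laurent_dual -> laurent_dual -> laurent_dual) : Prop :=
  lie_bracket mu /\
  forall u v, at_e0 (mu u v) = current_bracket br (at_e0 u) (at_e0 v).

Definition trivial_deformation : laurent_dual -> laurent_dual -> laurent_dual :=
  current_bracket (ext_bracket br : scalar_ext dual g -> _ -> _).

Definition equivalent_deformations
    (mu nu : laurent_dual -> laurent_dual -> laurent_dual) : Prop :=
  exists Phi : {linear laurent_dual -> laurent_dual},
    [/\ bijective Phi,
        forall u v, Phi (mu u v) = nu (Phi u) (Phi v)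
      & forall u, at_e0 (Phi u) = at_e0 u].

Definition infinitesimally_trivial
    (G : laurent_poly -> laurent_poly -> laurent_poly) : Prop :=
  exists mu, [/\ reduction_mod_e2 G mu,
                 infinitesimal_deformation mu
               & equivalent_deformations mu trivial_deformation].

End Deformations.

(* Main.v *)
Require Import Defs.
From HB Require Import structures.
From mathcomp Require Import all_boot all_order all_algebra.
From mathcomp Require Import finmap complex reals zify.

Set Implicit Arguments.
Unset Strict Implicit.
Unset Printing Implicit Defensive.

Import GRing.Theory.
Local Open Scope ring_scope.

(** Both cocycles measure the failure of the parity of the degree to be
    additive.  Let c(n) be -1/2 for n odd and 0 for n even: then
    c(n+m) - c(n) - c(m) is 1 when n and m are both odd and 0 otherwise.
    Hence, for any d, the linear map eta : x (x) A_n |-> c(n) x (x) A_(n-d)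
    satisfies omega_d(u,v) = eta([u,v]) - [u,eta(v)] - [eta(u),v]
    ([omega_coboundary]).  This holds over any base ring where 2 is
    invertible, and serves both over C and over C[e]/(e^2).  That omega_d is a
    cocycle is then the general fact that coboundaries are cocycles
    ([coboundary_two_cocycle]).

    Modulo e^2, each family has a bracket of the form
    [u,v] + eps omega_d(u,v), where (eps, d) is (3e, 2) for finite s and
    (-e, 4) for s infinite ([familyG_reduction]).  As eps^2 = 0, the map
    id - eps eta is invertible, with inverse id + eps eta, and it carries this
    bracket to the undeformed one ([coboundary_trivialization]).  The Lie
    axioms of the deformed bracket follow by transport along this bijection,
    and reduction at e = 0 is unaffected since eps vanishes there.

    Identities between additive expressions are checked on the generators
    x (x) A_n of the Laurent module, and a (x) x of the extension of scalars;
    [spans] is the corresponding induction principle. *)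

(** * Checking identities on additive generators *)

Local Notation bilinear b := (bilinear_for *:%R *:%R b).

Section Generators.
Variable V : zmodType.

(** [G] generates [V] as an additive monoid, in the form of an induction
    principle. *)
Definition spans (G : V -> Prop) : Prop :=
  forall P : V -> Prop, (forall x, G x -> P x) ->
    (forall x y, P x -> P y -> P (x + y)) -> forall x, P x.

Definition biadditive (W : zmodType) (b : V -> V -> W) : Prop :=
  (forall y, {morph b^~ y : x1 x2 / x1 + x2}) /\
  (forall x, {morph b x : y1 y2 / y1 + y2}).

Lemma biadditive_ext (W : zmodType) (G : V -> Prop) (b c : V -> V -> W) :
    spans G -> biadditive b -> biadditive c ->
    (forall x y, G x -> G y -> b x y = c x y) ->
  forall x y, b x y = c x y.
Proof.
move=> spG [bl br] [cl cr] eqG x y; elim/spG: x => [x Gx|x1 x2 e1 e2].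
  elim/spG: y => [y Gy|y1 y2 e1 e2]; first exact: eqG.
  by rewrite br cr e1 e2.
by rewrite bl cl e1 e2.
Qed.

End Generators.

Lemma additive0 (U W : zmodType) (f : U -> W) :
  {morph f : x y / x + y} -> f 0 = 0.
Proof. by move=> fD; apply: (addrI (f 0)); rewrite -fD !addr0. Qed.

Lemma additiveN (U W : zmodType) (f : U -> W) :
  {morph f : x y / x + y} -> {morph f : x / - x}.
Proof.
by move=> fD x; apply: (addrI (f x)); rewrite -fD !subrr additive0.
Qed.

Lemma bilinear_biadditive (K : comNzRingType) (V W : lmodType K)
    (b : V -> V -> W) : bilinear b -> biadditive b.
Proof.
by move=> [bl br]; split=> z x y; [have := bl z 1 x y | have := br z 1 x y];
  rewrite /= !scale1r.
Qed.

Lemma bilinearZ (K : comNzRingType) (V W : lmodType K) (b : V -> V -> W)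
    (a : K) x y :
  bilinear b -> b (a *: x) y = a *: b x y /\ b x (a *: y) = a *: b x y.
Proof.
move=> bil; have [bD bD'] := bilinear_biadditive bil.
have [bl br] := bil; split.
  by have := bl y a x 0; rewrite /= !addr0 (additive0 (bD y)) addr0.
by have := br x a y 0; rewrite /= !addr0 (additive0 (bD' x)) addr0.
Qed.

Section LieGenerators.
Variables (K : comNzRingType) (V : lmodType K) (b : V -> V -> V).

Lemma lie_skew : alternating_bilinear b -> forall x y, b x y = - b y x.
Proof.
move=> [/bilinear_biadditive[bl br] b0] x y; apply/eqP; rewrite -addr_eq0.
by have := b0 (x + y); rewrite bl !br !b0 add0r addr0 => ->.
Qed.

(** The condition [b x x = 0] is quadratic, so it does not extend additively by
    itself; skew-symmetry on generators controls the cross terms. *)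
Lemma lie_bracket_of_generators (G : V -> Prop) :
    spans G -> bilinear b ->
    (forall x, G x -> b x x = 0) ->
    (forall x y, G x -> G y -> b x y = - b y x) ->
    (forall x y z, G x -> G y -> G z ->
      b x (b y z) + b y (b z x) + b z (b x y) = 0) ->
  lie_bracket b.
Proof.
move=> spG bil b0 bN bJ; have [bl br] := bilinear_biadditive bil.
have skew x y : b x y = - b y x.
  apply: (biadditive_ext spG (conj bl br) _ bN x y).
  by split=> z u v; rewrite ?bl ?br opprD.
split; first (split=> // x; elim/spG: x => [x /b0 //|x y ex ey]).
  by rewrite bl !br ex ey (skew y x) add0r addr0 subrr.
have sum0 (u1 u2 u3 v1 v2 v3 : V) : u1 + u2 + u3 = 0 -> v1 + v2 + v3 = 0 ->
    (u1 + v1) + (u2 + v2) + (u3 + v3) = 0.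
  by move=> eu ev; rewrite (addrACA u1) (addrACA (u1 + u2)) eu ev addr0.
move=> x y z; elim/spG: x => [x Gx|x1 x2 e1 e2]; last first.
  by rewrite !(bl, br); apply: sum0.
elim/spG: y => [y Gy|y1 y2 e1 e2]; last by rewrite !(bl, br); apply: sum0.
elim/spG: z => [z Gz|z1 z2 e1 e2]; last by rewrite !(bl, br); apply: sum0.
exact: bJ.
Qed.

(** Gives the Lie axioms of a deformed bracket from those of the undeformed one,
    once the two are intertwined. *)
Lemma lie_bracket_pullback (mu : V -> V -> V) (Phi : {linear V -> V}) :
    injective Phi -> (forall x y, Phi (mu x y) = b (Phi x) (Phi y)) ->
  lie_bracket b -> lie_bracket mu.
Proof.
move=> injPhi PhiM [[[bl br] b0] bJ]; split; first split.
- by split=> z a x y; apply: injPhi; rewrite PhiM !linearP !PhiM;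
    [apply: bl | apply: br].
- by move=> x; apply: injPhi; rewrite PhiM b0 linear0.
- by move=> x y z; apply: injPhi; rewrite !linearD !PhiM bJ linear0.
Qed.

End LieGenerators.

(** * Coboundaries and first-order deformations *)

Section Coboundaries.
Variables (K : comNzRingType) (V : lmodType K) (b : V -> V -> V).

(** The cocycle identity for [omega = d eta] splits into four Jacobi identities,
    for the triples (x,y,z), (eta x,y,z), (x,eta y,z) and (x,y,eta z), plus
    three pairs of terms [c, eta [a,a']] of opposite signs. *)
Lemma coboundary_two_cocycle (w : V -> V -> V) :
  lie_bracket b -> coboundary b w -> two_cocycle b w.
Proof.
move=> [altb bJ] [eta wE]; have [bil b0] := altb; have skew := lie_skew altb.
have [bl br] := bilinear_biadditive bil.
have brN u v : b u (- v) = - b u v by apply: (additiveN (br u)).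
have altw : alternating_bilinear w.
  split=> [|x]; last first.
    by rewrite wE b0 linear0 sub0r (skew x) opprK subrr.
  case: bil => bll blr; split=> z a u v /=; rewrite !wE !linearP.
    by rewrite bll linearP !bll !opprD !scalerBr
      [LHS](AC (2*2*2) ((1*3*5)*(2*4*6))).
  by rewrite blr linearP !blr !opprD !scalerBr
      [LHS](AC (2*2*2) ((1*3*5)*(2*4*6))).
split=> // x y z; have wskew := lie_skew altw.
have [wl _] := bilinear_biadditive altw.1.
have wN u v : w (- u) v = - w u v by apply: (additiveN (wl v)).
have outer a a' c : w (b a a') c =
    - eta (b c (b a a')) + b (eta c) (b a a') + b c (eta (b a a')).
  by rewrite wE (skew _ c) (skew _ (eta c)) (skew _ c) linearN !opprK.
have inner a a' c : - b c (w a a') =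
    - b c (eta (b a a')) + b c (b a (eta a')) + b c (b (eta a) a').
  by rewrite wE !(br, brN) !opprD !opprK.
(* This makes the identity cyclic in x, y, z. *)
rewrite (skew x z) wN opprK (wskew x z) brN !outer !inner.
rewrite [LHS](AC (3*3*3*3*3*3)
  ((7*4*1)*((8*14*18)*(12*5*17)*(11*15*2))*((3*16)*(6*13)*(9*10)))) /=.
by rewrite !bJ !subrr -!opprD -!linearD bJ linear0 oppr0 !addr0.
Qed.

(** A first-order deformation along a coboundary is undone by
    [Phi = id - eps eta].  In [[Phi u, Phi v]] the term quadratic in eps
    vanishes, and the linear one is the coboundary formula. *)
Lemma coboundary_trivialization (w : V -> V -> V) (eps : K) :
    bilinear b -> coboundary b w -> eps * eps = 0 ->
  exists Phi : {linear V -> V},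
    [/\ bijective Phi,
        forall u v, Phi (b u v + eps *: w u v) = b (Phi u) (Phi v)
      & forall u, exists u', Phi u = u + eps *: u'].
Proof.
move=> [bl br] [eta wE] eps2.
pose twist a : {linear V -> V} := idfun \+ (a \*: eta).
have twistE a u : twist a u = a *: eta u + u by exact: addrC.
have twistK a : a * a = 0 -> cancel (twist a) (twist (- a)).
  move=> a2 u; rewrite !twistE linearD linearZ /= scalerDr scalerA mulNr a2.
  by rewrite oppr0 scale0r add0r scaleNr addKr.
exists (twist (- eps)); split=> [|u v|u]; last first.
- by exists (- eta u); rewrite twistE addrC scalerN scaleNr.
- have eps2v x : eps *: (eps *: x) = 0 by rewrite scalerA eps2 scale0r.
  rewrite !twistE linearD linearZ /= wE bl !br /=.
  rewrite !(scaleNr, scalerDr, scalerN) !eps2v !(addr0, oppr0, add0r).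
  rewrite [LHS]addrCA -(addrA (eps *: _)) addKr.
  by rewrite addrC addrA (addrC (- _) (- _)).
- exists (twist (- - eps)); first by apply: twistK; rewrite mulrNN.
  by rewrite opprK; apply: twistK.
Qed.

End Coboundaries.

(** * Maps out of the Laurent module *)

Section LaurentMaps.
Variables (M N : zmodType).

Definition is_tensA (u : laurent M) : Prop := exists x n, u = x *A n.

Definition lin_ext (f : int -> M -> N) (u : laurent M) : N :=
  \sum_(n <- finsupp u) f n (u n).

(** Widening the range of summation allows the sums for [u], [v] and [u + v]
    to be taken over one common set, although their supports differ. *)
Lemma lin_ext_wide (f : int -> M -> N) (u : laurent M) (S : {fset int}) :
    (forall n, f n 0 = 0) -> (finsupp u `<=` S)%fset ->
  lin_ext f u = \sum_(n <- S) f n (u n).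
Proof.
move=> f0 uS; apply: big_fset_incl => // n _.
by rewrite mem_finsupp negbK => /eqP ->.
Qed.

Lemma finsupp_tensA (x : M) n : (finsupp (x *A n) `<=` [fset n])%fset.
Proof.
apply/fsubsetP => k; rewrite mem_finsupp tensAE in_fset1.
by case: (k == n); rewrite ?eqxx.
Qed.

Lemma lin_ext_tensA (f : int -> M -> N) (x : M) n :
  (forall n, f n 0 = 0) -> lin_ext f (x *A n) = f n x.
Proof.
move=> f0; rewrite (lin_ext_wide f0 (finsupp_tensA x n)).
by rewrite big_seq_fset1 tensAE eqxx.
Qed.

Lemma lin_ext_additive (f : int -> M -> N) :
  (forall n, {morph f n : x y / x + y}) -> {morph lin_ext f : u v / u + v}.
Proof.
move=> fD u v; have f0 n : f n 0 = 0 := additive0 (fD n).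
pose S := (finsupp u `|` finsupp v `|` finsupp (u + v)%R)%fset.
have subS : [/\ finsupp u `<=` S, finsupp v `<=` S
    & finsupp (u + v)%R `<=` S]%fset.
  by split; apply/fsubsetP => n; rewrite !in_fsetU => ->; rewrite ?orbT.
have [su sv suv] := subS; rewrite (lin_ext_wide f0 su) (lin_ext_wide f0 sv).
rewrite (lin_ext_wide f0 suv) -big_split /=.
by apply: eq_bigr => n _; rewrite laurentD fD.
Qed.

End LaurentMaps.

Section TensA.
Variables (M : zmodType) (n : int).

Lemma tensAD (x y : M) : (x + y) *A n = x *A n + y *A n.
Proof.
by apply/fsfunP => k; rewrite laurentD !tensAE; case: eqP; rewrite ?addr0.
Qed.

Lemma tensA0 : (0 : M) *A n = 0.
Proof. exact: (additive0 (f := fun x => x *A n) tensAD). Qed.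

Lemma tensAN (x : M) : (- x) *A n = - (x *A n).
Proof. exact: (additiveN (f := fun x => x *A n) tensAD). Qed.

End TensA.

Lemma tensAZ (K : nzRingType) (M : lmodType K) (a : K) (x : M) n :
  (a *: x) *A n = a *: (x *A n).
Proof.
by apply/fsfunP => k; rewrite laurentZ !tensAE; case: eqP; rewrite ?scaler0.
Qed.

Lemma lin_ext_id (M : zmodType) (u : laurent M) :
  lin_ext (fun n x => x *A n) u = u.
Proof.
apply/fsfunP => k.
have evalD : {morph (fun v : laurent M => v k) : v w / v + w}.
  by move=> v w; rewrite laurentD.
rewrite /lin_ext (big_morph _ evalD (laurent0 M k)).
under eq_bigr do rewrite tensAE eq_sym.
rewrite -big_mkcond /=; case: finsuppP => uk.
  by rewrite big1 // => i /eqP ->; rewrite fsfun_dflt.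
by rewrite -big_filter filter_pred1_uniq ?fset_uniq // big_seq1.
Qed.

Lemma laurent_spans (M : zmodType) : spans (@is_tensA M).
Proof.
move=> P PA PD u; rewrite -(lin_ext_id u) /lin_ext.
elim/big_ind: _ => [|//|n _]; last by apply: PA; exists (u n), n.
by rewrite -(tensA0 M 0); apply: PA; exists 0, 0.
Qed.

Section BilinearExtension.
Variables (M N : zmodType) (f : int -> int -> M -> M -> laurent N).
Hypothesis fD : forall n m, biadditive (f n m).

Lemma bilin_ext_biadditive : biadditive (bilin_ext f).
Proof.
split=> w u v.
  refine (lin_ext_additive
    (f := fun n x => lin_ext (fun m => f n m x) w) _ u v).
  move=> n x y; rewrite /lin_ext -big_split.
  by apply: eq_bigr => m _; apply: (fD n m).1.
rewrite /bilin_ext -big_split; apply: eq_bigr => n _.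
by refine (lin_ext_additive _ u v) => m; apply: (fD n m).2.
Qed.

Lemma bilin_extE n m x y : bilin_ext f (x *A n) (y *A m) = f n m x y.
Proof.
apply: bilin_ext_tensA => i j z.
  exact: (additive0 ((fD i j).1 z)).
exact: (additive0 ((fD i j).2 z)).
Qed.

End BilinearExtension.

Section LinearExtension.
Variables (K : comNzRingType) (M N : lmodType K).

Lemma lin_ext_linear (f : int -> M -> N) :
  (forall n, linear (f n)) -> linear (lin_ext f).
Proof.
move=> flin a u v.
have fD n : {morph f n : x y / x + y}.
  by move=> x y; have := flin n 1 x y; rewrite !scale1r.
have f0 n : f n 0 = 0 := additive0 (fD n).
have fZ n x : f n (a *: x) = a *: f n x.
  by have := flin n a x 0; rewrite !addr0 f0 addr0.
rewrite (lin_ext_additive fD); congr (_ + _).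
have su : (finsupp (a *: u) `<=` finsupp u)%fset.
  apply/fsubsetP => n; rewrite !mem_finsupp laurentZ.
  by apply: contraNneq => ->; rewrite scaler0.
rewrite (lin_ext_wide f0 su) /lin_ext scaler_sumr.
by apply: eq_bigr => n _; rewrite laurentZ fZ.
Qed.

End LinearExtension.

Lemma bilin_ext_bilinear (K : comNzRingType) (M N : lmodType K)
    (f : int -> int -> M -> M -> laurent N) :
  (forall n m, bilinear (f n m)) -> bilinear (bilin_ext f).
Proof.
move=> fbil; split=> w a u v /=.
  refine (@lin_ext_linear K M (laurent N)
    (fun n x => lin_ext (fun m => f n m x) w) _ a u v).
  move=> n c x y; rewrite /lin_ext scaler_sumr -big_split.
  by apply: eq_bigr => m _; apply: (fbil n m).1.
rewrite /bilin_ext scaler_sumr -big_split; apply: eq_bigr => n _.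
by refine (lin_ext_linear _ a u v) => m; apply: (fbil n m).2.
Qed.

(** * The current algebra and its parity cocycles *)

Lemma oddzD n m : oddz (n + m) = oddz n (+) oddz m.
Proof. by rewrite /oddz; lia. Qed.

Section CurrentAlgebra.
Variables (K : comNzRingType) (M : lmodType K) (br : M -> M -> M).
Hypothesis br_bil : bilinear br.

Lemma bilinear_tensA (n : int) : bilinear (fun x y => br x y *A n).
Proof.
have [bl brr] := br_bil.
by split=> z a x y /=; rewrite ?bl ?brr tensAD tensAZ.
Qed.

Lemma current_bracket_bilinear : bilinear (current_bracket br).
Proof. by apply: bilin_ext_bilinear => n m; apply: bilinear_tensA. Qed.

Lemma current_bracketE n m x y :
  current_bracket br (x *A n) (y *A m) = br x y *A (n + m).
Proof.
by apply: bilin_extE => i j; apply/bilinear_biadditive/bilinear_tensA.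
Qed.

Lemma bilinear_omega (d n m : int) : bilinear (fun x y =>
  if oddz n && oddz m then br x y *A (n + m - d) else 0).
Proof.
case: (oddz n && oddz m); first exact: bilinear_tensA.
by split=> z a x y /=; rewrite scaler0 addr0.
Qed.

Lemma omegaE d n m x y : omega br d (x *A n) (y *A m) =
  if oddz n && oddz m then br x y *A (n + m - d) else 0.
Proof.
by apply: bilin_extE => i j; apply/bilinear_biadditive/bilinear_omega.
Qed.

Lemma omega_bilinear d : bilinear (omega br d).
Proof. by apply: bilin_ext_bilinear => n m; apply: bilinear_omega. Qed.

Section Primitive.
Variables (h : K) (d : int).
Hypothesis h2 : h + h = 1.

(** The primitive eta of [omega br d]; [h] is one half. *)
Definition odd_shift : laurent M -> laurent M :=
  lin_ext (fun n x => if oddz n then (- h *: x) *A (n - d) else 0).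

Lemma odd_shift_linear : linear odd_shift.
Proof.
apply: lin_ext_linear => n a x y; case: ifP => _; last by rewrite scaler0 addr0.
by rewrite scalerDr tensAD !scalerA (mulrC (- h)) -scalerA tensAZ.
Qed.

HB.instance Definition _ :=
  GRing.isLinear.Build K (laurent M) (laurent M) *:%R odd_shift
    odd_shift_linear.

Lemma odd_shiftE x n :
  odd_shift (x *A n) = if oddz n then (- h *: x) *A (n - d) else 0.
Proof.
apply: lin_ext_tensA => m; case: ifP => // _.
by rewrite scaler0 tensA0.
Qed.

(** On x (x) A_n and y (x) A_m the right-hand side has coefficient
    c(n+m) - c(n) - c(m) with c(n) = - h for n odd and 0 for n even; it is h + h
    when both are odd, and 0 otherwise. *)
Lemma omega_coboundary : coboundary (current_bracket br) (omega br d).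
Proof.
exists odd_shift; have [cD cD'] := bilinear_biadditive current_bracket_bilinear.
apply: (biadditive_ext (@laurent_spans M)).
- exact/bilinear_biadditive/omega_bilinear.
- split=> z u v /=; rewrite !(cD, cD', linearD) /=.
    by rewrite [LHS](AC (2*2*2) ((1*3*5)*(2*4*6))).
  by rewrite [LHS](AC (2*2*2) ((1*3*5)*(2*4*6))).
move=> _ _ [x [n ->]] [y [m ->]].
have cur0 u : current_bracket br 0 u = 0 by apply: (additive0 (cD u)).
have cur0' u : current_bracket br u 0 = 0 by apply: (additive0 (cD' u)).
have [brZ brZ'] := bilinearZ (- h) x y br_bil.
rewrite omegaE /= !(current_bracketE, odd_shiftE) oddzD.
case: (oddz n) (oddz m) => [] [] /=.
- by rewrite !current_bracketE brZ brZ' addrA (addrAC n) sub0r -opprD -tensAD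
    -scalerDl -opprD h2 -tensAN -scaleNr opprK scale1r.
- by rewrite cur0' !current_bracketE brZ (addrAC n) subr0 subrr.
- by rewrite cur0 !current_bracketE brZ' addrA subr0 subrr.
- by rewrite cur0 cur0' !subr0.
Qed.

End Primitive.
End CurrentAlgebra.

Lemma current_lie_bracket (K : comNzRingType) (M : lmodType K)
    (br : M -> M -> M) :
  lie_bracket br -> lie_bracket (current_bracket br).
Proof.
move=> [altbr brJ]; have skew := lie_skew altbr.
apply: (lie_bracket_of_generators (@laurent_spans M)).
- exact: current_bracket_bilinear altbr.1.
- by move=> _ [x [n ->]]; rewrite (current_bracketE altbr.1) altbr.2 tensA0.
- move=> _ _ [x [n ->]] [y [m ->]].
  by rewrite !(current_bracketE altbr.1) skew addrC tensAN.
- move=> _ _ _ [x [n ->]] [y [m ->]] [z [p ->]].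
  rewrite !(current_bracketE altbr.1).
  by rewrite (addrC p n) (addrCA m n) (addrC p (n + m)) -(addrA n) -!tensAD
    brJ tensA0.
Qed.

(** * Extension of scalars *)

Section ScalarExtensionGenerators.
Variables (F : fieldType) (K : comAlgType F) (g : vectType F).

Definition is_ext_tens (u : scalar_ext K g) : Prop :=
  exists a x, u = ext_tens a x.

Lemma ext_tensD (a : K) :
  {morph (ext_tens a : g -> scalar_ext K g) : x y / x + y}.
Proof. by move=> x y; apply/rowP => i; rewrite !mxE linearD scalerDl. Qed.

Lemma ext_tens_spans : spans is_ext_tens.
Proof.
move=> P PT PD u.
have -> : u = \sum_i ext_tens (u 0 i) (vbasis {:g})`_i.
  apply/rowP => k; rewrite summxE (bigD1 k) //= big1 => [|i ik]; last first.
    rewrite mxE coord_free ?(basis_free (vbasisP _)) //.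
    by case: eqP ik => [->|]; rewrite ?eqxx ?scale0r.
  by rewrite mxE coord_free ?(basis_free (vbasisP _)) // eqxx scale1r addr0.
elim/big_ind: _ => [|//|i _]; last first.
  by apply: PT; exists (u 0 i), (vbasis {:g})`_i.
by rewrite -(additive0 (ext_tensD 0)); apply: PT; exists 0, 0.
Qed.

Variable br : g -> g -> g.

Lemma ext_tensDl (x : g) (a b : K) :
  ext_tens (a + b) x = ext_tens a x + ext_tens b x :> scalar_ext K g.
Proof. by apply/rowP => i; rewrite !mxE scalerDr. Qed.

Lemma ext_tensZ (x : g) (c a : K) :
  ext_tens (c * a) x = c *: (ext_tens a x : scalar_ext K g).
Proof. by apply/rowP => i; rewrite !mxE scalerAr. Qed.

Lemma ext_bracket_bilinear :
  bilinear (ext_bracket br : scalar_ext K g -> _ -> _).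
Proof.
split=> w c u v /=; rewrite /ext_bracket scaler_sumr -big_split /=;
  apply: eq_bigr => i _; rewrite scaler_sumr -big_split /=;
  apply: eq_bigr => j _; rewrite -ext_tensZ -ext_tensDl !mxE.
  by rewrite mulrDl mulrA.
by rewrite mulrDr mulrCA.
Qed.

Lemma ext_lie_bracket :
  lie_bracket br -> lie_bracket (ext_bracket br : scalar_ext K g -> _ -> _).
Proof.
move=> [altbr brJ]; have skew := lie_skew altbr.
have E (a b : K) x y : ext_bracket br (ext_tens a x) (ext_tens b y) =
  ext_tens (a * b) (br x y) by apply: ext_bracket_tens altbr.1.
apply: (lie_bracket_of_generators ext_tens_spans ext_bracket_bilinear).
- by move=> _ [a [x ->]]; rewrite E altbr.2 (additive0 (ext_tensD _)).
- move=> _ _ [a [x ->]] [b [y ->]].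
  by rewrite !E skew mulrC (additiveN (ext_tensD _)).
- move=> _ _ _ [a [x ->]] [b [y ->]] [c [z ->]]; rewrite !E.
  rewrite (mulrC c a) (mulrCA b) (mulrC c (a * b)) -(mulrA a) -!ext_tensD brJ.
  exact: additive0 (ext_tensD _).
Qed.

End ScalarExtensionGenerators.
Section LaurentMap.
Variables (M N : zmodType) (f : M -> N).
Hypothesis fD : {morph f : x y / x + y}.

Lemma laurent_mapE u n : laurent_map f u n = f (u n).
Proof. by rewrite fsfunE; case: finsuppP => //; rewrite (additive0 fD). Qed.

Lemma laurent_mapD : {morph laurent_map f : u v / u + v}.
Proof.
by move=> u v; apply/fsfunP => n; rewrite !(laurent_mapE, laurentD) fD.
Qed.

Lemma laurent_map_tensA x n : laurent_map f (x *A n) = f x *A n.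
Proof.
apply/fsfunP => k; rewrite laurent_mapE !tensAE.
by case: ifP => // _; rewrite (additive0 fD).
Qed.

End LaurentMap.

Section ChangeOfScalars.
Variables (F : fieldType) (K K' : comAlgType F) (g : vectType F) (f : K -> K').
Hypothesis fD : {morph f : a b / a + b}.
Hypothesis fM : {morph f : a b / a * b}.
Hypothesis fZ : forall c : F, {morph f : a / c *: a}.
Implicit Types u v : scalar_ext K g.

Lemma ext_mapD : {morph (ext_map f : scalar_ext K g -> _) : u v / u + v}.
Proof. by move=> u v; apply/rowP => i; rewrite !mxE fD. Qed.

Lemma ext_mapZ c u : ext_map f (c *: u) = f c *: ext_map f u.
Proof. by apply/rowP => i; rewrite !mxE fM. Qed.

Lemma ext_map_tens a x :
  ext_map f (ext_tens a x : scalar_ext K g) = ext_tens (f a) x.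
Proof. by apply/rowP => i; rewrite !mxE fZ. Qed.

Lemma ext_map_bracket (br : g -> g -> g) u v :
  ext_map f (ext_bracket br u v) = ext_bracket br (ext_map f u) (ext_map f v).
Proof.
rewrite /ext_bracket (big_morph _ ext_mapD (additive0 ext_mapD)).
apply: eq_bigr => i _; rewrite (big_morph _ ext_mapD (additive0 ext_mapD)).
by apply: eq_bigr => j _; rewrite ext_map_tens fM !mxE.
Qed.

End ChangeOfScalars.

(** * Dual numbers and reduction at e = 0 *)

Section DualNumbers.
Variables (F : fieldType).
Notation dual := {poly %/ ('X^2 : {poly F})}.
Notation mod_X2 := (in_qpoly ('X^2 : {poly F}) : {poly F} -> dual).

Lemma coef0_in_qpoly (p : {poly F}) : (mod_X2 p : {poly F})`_0 = p`_0.
Proof.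
rewrite [in RHS](Pdiv.RingMonic.rdivp_eq (monic_mk_monic ('X^2 : {poly F})) p).
by rewrite coefD [in X in _ * X]mk_monic_Xn coefMXn add0r.
Qed.

Lemma coef0_dualM (p q : dual) :
  ((p * q : dual) : {poly F})`_0 = (p : {poly F})`_0 * (q : {poly F})`_0.
Proof.
by rewrite poly_of_qpolyM -coef0M; apply: coef0_in_qpoly.
Qed.

Lemma in_qpoly_X2M (p : {poly F}) : mod_X2 ('X^2 * p) = 0.
Proof.
apply/val_inj => /=; rewrite mk_monic_Xn mulrC.
by rewrite Pdiv.RingMonic.rmodp_mull // monicXn.
Qed.

Variable g : vectType F.

(** The reduction at e = 0 of one coefficient: [at_e0] is, by conversion,
    [laurent_map eval0]. *)
Definition eval0 (x : scalar_ext dual g) : g :=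
  \sum_i (x 0 i : {poly F})`_0 *: (vbasis {:g})`_i.

Lemma eval0D : {morph eval0 : x y / x + y}.
Proof.
move=> x y; rewrite /eval0 -big_split; apply: eq_bigr => i _ /=.
by rewrite mxE coefD scalerDl.
Qed.

Lemma eval0_tens (a : dual) (x : g) :
  eval0 (ext_tens a x) = (a : {poly F})`_0 *: x.
Proof.
rewrite [in RHS](coord_vbasis (memvf x)) scaler_sumr.
by apply: eq_bigr => i _; rewrite mxE coefZ scalerA mulrC.
Qed.

Lemma eval0Z (a : dual) (x : scalar_ext dual g) :
  eval0 (a *: x) = (a : {poly F})`_0 *: eval0 x.
Proof.
rewrite scaler_sumr; apply: eq_bigr => i _.
by rewrite mxE coef0_dualM scalerA.
Qed.

Lemma eval0_bracket (br : g -> g -> g) (x y : scalar_ext dual g) :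
  bilinear br -> eval0 (ext_bracket br x y) = br (eval0 x) (eval0 y).
Proof.
move=> br_bil; have [brD brD'] := bilinear_biadditive br_bil.
have [eD eD'] := bilinear_biadditive (ext_bracket_bilinear dual br).
move: x y; apply: (biadditive_ext (b := fun x y => eval0 (ext_bracket br x y))
  (c := fun x y => br (eval0 x) (eval0 y)) (@ext_tens_spans F dual g)).
- by split=> z u v; rewrite ?eD ?eD' eval0D.
- by split=> z u v; rewrite eval0D ?brD ?brD'.
move=> _ _ [a [u ->]] [b [v ->]].
rewrite (ext_bracket_tens _ _ _ _ br_bil) !eval0_tens coef0_dualM.
by rewrite (bilinearZ _ _ _ br_bil).1 (bilinearZ _ _ _ br_bil).2 scalerA.
Qed.

End DualNumbers.

Lemma half_double (F : fieldType) :
  2%:R != 0 :> F -> 2%:R^-1 + 2%:R^-1 = 1 :> F.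
Proof. by move=> n2; apply: (mulIf n2); rewrite mulrDl mulVf // mul1r. Qed.

(** * The families over the dual numbers *)

Section Trivialization.
Variables (F : fieldType) (g : vectType F) (br : g -> g -> g).
Hypothesis br_lie : lie_bracket br.
Hypothesis two_neq0 : 2%:R != 0 :> F.
Notation dual := {poly %/ ('X^2 : {poly F})}.
Notation laurent_poly := (laurent (scalar_ext {poly F} g)).
Notation laurent_dual := (laurent (scalar_ext dual g)).
Notation mod_X2 := (in_qpoly ('X^2 : {poly F}) : {poly F} -> dual).
Notation ebr := (ext_bracket br : scalar_ext dual g -> _ -> _).

Definition deformed_bracket (eps : dual) (d : int) (u v : laurent_dual) :
    laurent_dual :=
  current_bracket ebr u v + eps *: omega ebr d u v.

(** The parameter is a multiple of e in order to square to 0 and to vanish at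
    e = 0. *)
Lemma deformed_bracket_trivial
    (G : laurent_poly -> laurent_poly -> laurent_poly)
    (p : {poly F}) (d : int) :
    reduction_mod_e2 G (deformed_bracket (mod_X2 ('X * p)) d) ->
  infinitesimally_trivial br G.
Proof.
move=> red; set eps := mod_X2 ('X * p) in red.
pose e_lie := ext_lie_bracket dual br_lie.
have eps2 : eps * eps = 0.
  by rewrite /eps -rmorphM /= mulrACA -expr2 in_qpoly_X2M.
have eps0 : (eps : {poly F})`_0 = 0 by rewrite coef0_in_qpoly coefXM.
have half : (2%:R^-1)%:A + (2%:R^-1)%:A = 1 :> dual.
  by rewrite -scalerDl half_double // scale1r.
have cur_lie := current_lie_bracket e_lie.
have [Phi [bijPhi PhiM PhiE]] := coboundary_trivialization cur_lie.1.1
  (omega_coboundary e_lie.1.1 d half) eps2.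
have at0D : {morph (@at_e0 F g) : u v / u + v} := laurent_mapD (@eval0D F g).
have at0T x n : at_e0 (x *A n) = eval0 x *A n :=
  laurent_map_tensA (@eval0D F g) x n.
have at0Z (u : laurent_dual) : at_e0 (eps *: u) = 0.
  apply/fsfunP => n; rewrite (laurent_mapE (@eval0D F g)) laurentZ laurent0.
  by rewrite eval0Z eps0 scale0r.
have at0M u v : at_e0 (current_bracket ebr u v) =
    current_bracket br (at_e0 u) (at_e0 v).
  have [cD cD'] := bilinear_biadditive cur_lie.1.1.
  have [bD bD'] := bilinear_biadditive (current_bracket_bilinear br_lie.1.1).
  move: u v; apply: (biadditive_ext
    (b := fun u v => at_e0 (current_bracket ebr u v))
    (c := fun u v => current_bracket br (at_e0 u) (at_e0 v))
    (@laurent_spans _)).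
  - by split=> z u v; rewrite ?cD ?cD' at0D.
  - by split=> z u v; rewrite at0D ?bD ?bD'.
  move=> _ _ [x [n ->]] [y [m ->]].
  rewrite (current_bracketE e_lie.1.1) !at0T (current_bracketE br_lie.1.1).
  by rewrite eval0_bracket //; case: br_lie => [[]].
exists (deformed_bracket eps d); split=> //; last first.
  by exists Phi; split=> // u; have [u' ->] := PhiE u; rewrite at0D at0Z addr0.
split; last by move=> u v; rewrite at0D at0Z addr0 at0M.
exact: (lie_bracket_pullback (mu := deformed_bracket eps d)
  (bij_inj bijPhi) PhiM cur_lie).
Qed.

(** The coefficient of e^2 dies, so for finite s the reduction no longer
    depends on s. *)
Lemma familyG_reduction (s : option F) :
  reduction_mod_e2 (familyG br s)
    (deformed_bracket (mod_X2 ('X * (if s is Some _ then 3%:R else -1)))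
      (if s is Some _ then 2 else 4)).
Proof.
have X2D := @in_qpolyD F 'X^2; have X2M := @in_qpolyM F 'X^2.
have X2Z c : {morph mod_X2 : p / c *: p} by move=> p; apply: in_qpolyZ.
have xmD : {morph (ext_map mod_X2 : scalar_ext {poly F} g -> _) : x y / x + y}.
  exact: ext_mapD.
have mD : {morph (@mod_e2 F g) : u v / u + v} := laurent_mapD xmD.
have mT x n : mod_e2 (x *A n) = ext_map mod_X2 x *A n :=
  laurent_map_tensA xmD x n.
have mN := additiveN mD.
have e_lie := ext_lie_bracket dual br_lie.
have [cD cD'] := bilinear_biadditive (current_bracket_bilinear e_lie.1.1).
have wD d := bilinear_biadditive (omega_bilinear e_lie.1.1 d).
have [eD eD'] := bilinear_biadditive (ext_bracket_bilinear {poly F} br).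
set eps := mod_X2 _; set d := (X in deformed_bracket _ X).
have defD : biadditive (deformed_bracket eps d).
  split=> w u v; rewrite /deformed_bracket.
    by rewrite cD (wD d).1 scalerDr addrACA.
  by rewrite cD' (wD d).2 scalerDr addrACA.
pose coefG n m (z : scalar_ext {poly F} g) : laurent_poly :=
  if oddz n && oddz m then
    if s is Some s' then
      z *A (n + m) + ((3%:R * 'X) *: z) *A (n + m - 2)
      + (('X^2 * ((1 - s') * (2%:R + s'))%:P) *: z) *A (n + m - 4)
    else z *A (n + m) - ('X *: z) *A (n + m - 4)
  else z *A (n + m).
have coefGD n m : {morph coefG n m : z z' / z + z'}.
  move=> z z'; rewrite /coefG; case: (_ && _); last exact: tensAD.
  case: (s) => [s'|]; rewrite !scalerDr !tensAD ?opprD.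
    by rewrite [LHS](AC (2*2*2) ((1*3*5)*(2*4*6))).
  by rewrite addrACA.
have Gbi n m : biadditive (fun x y => coefG n m (ext_bracket br x y)).
  by split=> w x y; rewrite ?eD ?eD' coefGD.
have [GD GD'] : biadditive (familyG br s) := bilin_ext_biadditive Gbi.
move=> u v; apply: (biadditive_ext (b := fun u v => mod_e2 (familyG br s u v))
  (c := fun u v => deformed_bracket eps d (mod_e2 u) (mod_e2 v))
  (@laurent_spans _)).
- by split=> w u1 u2; rewrite ?GD ?GD' mD.
- by split=> w u1 u2; rewrite mD ?defD.1 ?defD.2.
move=> _ _ [x [n ->]] [y [m ->]] {u v}.
rewrite [familyG _ _ _ _](bilin_extE Gbi) !mT /deformed_bracket.
rewrite (current_bracketE e_lie.1.1) (omegaE e_lie.1.1).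
rewrite -(ext_map_bracket X2D X2M X2Z) /coefG.
set z := ext_bracket br x y.
case: (_ && _); last by rewrite mT scaler0 addr0.
rewrite /eps /d -tensAZ -(ext_mapZ X2M).
case: (s) => [s'|]; rewrite !mD ?mN !mT.
  by rewrite (ext_mapZ X2M (_ * _%:P)) in_qpoly_X2M scale0r tensA0 addr0 mulrC.
by rewrite mulrN1 scaleNr (additiveN xmD) tensAN.
Qed.

Lemma familyG_trivial (s : option F) :
  infinitesimally_trivial br (familyG br s).
Proof. exact: deformed_bracket_trivial (familyG_reduction s). Qed.

End Trivialization.

Theorem proposition6p1 (R : realType) (g : vectType R[i]) (br : g -> g -> g)
    (br_lie : lie_bracket br) :
  [/\ two_cocycle (current_bracket br) (omega br 2) /\
        coboundary (current_bracket br) (omega br 2),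
      two_cocycle (current_bracket br) (omega br 4) /\
        coboundary (current_bracket br) (omega br 4)
    & forall s : option R[i], infinitesimally_trivial br (familyG br s)].
Proof.
have two_neq0 : 2%:R != 0 :> R[i] by rewrite Num.Theory.pnatr_eq0.
have half := half_double two_neq0.
have cob d := omega_coboundary br_lie.1.1 d half.
have coc d := coboundary_two_cocycle (current_lie_bracket br_lie) (cob d).
by split=> [||s]; [split| split| apply: familyG_trivial].
Qed.
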